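(* Let $d$ be a positive integer, let $F$ be a Young diagram, and let $w\in\{+,-\}^k$ be the type sequence encoding the outer boundary of $F$. (a) For any $d$-RSK growth diagram on $F$, the sequence of partitions $\lambda^{(0)},\ldots,\lambda^{(k)}$ assigned to the lattice points on the outer boundary of $F$ (listed in order starting from the point on the positive $x$-axis) is a $d$-semistandard $w$-oscillating tableau, and the filling of the diagram avoids the pattern $d\cdots1(d+1)$. (b) Every filling of $F$ that avoids the pattern $d\cdots 1(d+1)$ extends uniquely to a $d$-RSK growth diagram on $F$ (i.e. there is a unique assignment of partitions to the lattice points of $F$ making it a $d$-RSK growth diagram with that filling). (c) Every $d$-semistandard $w$-oscillating tableau, assigned in order to the lattice points along the outer boundary of $F$ (starting from the point on the positive $x$-axis), extends uniquely to a $d$-RSK growth diagram on $F$ (i.e. there is a unique filling of $F$ and a unique assignment of partitions to the remaining lattice points making it a $d$-RSK growth diagram). Consequently, there is an explicit bijection between fillings of $F$ that avoid the pattern $d\cdots1(d+1)$ and $d$-semistandard $w$-oscillating tableaux.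
   Context: Partitions: finite weakly decreasing sequences of positive integers, with $\lambda_i=0$ for $i>\ell(\lambda)$; $|\lambda|=\sum\lambda_i$; a $d$-partition has $\ell(\lambda)\le d$. Interlacing: $\alpha\prec\beta$ (also written $\beta\succ\alpha$) means $\beta_1\ge\alpha_1\ge\beta_2\ge\alpha_2\ge\beta_3\ge\cdots$. Young diagrams are drawn in the first quadrant, made of unit cells with integer-lattice-point corners, left-justified with row 1 adjacent to the $x$-axis (English conventions reflected: rows stack upward). Its lattice points are the corners of its cells. A filling assigns a nonnegative integer entry to each cell. The outer boundary of a nonempty Young diagram is the lattice path from the positive $x$-axis to the positive $y$-axis consisting of unit steps up or left; its type sequence records `$+$' for each up step and `$-$' for each left step, in order. A filling contains the pattern $d\cdots1(d+1)$ if there are $d+1$ cells with nonzero entries $c_1,\dots,c_{d+1}$ such that each $c_{i+1}$ ($i<d$) lies strictly below and strictly to the right of $c_i$, and $c_{d+1}$ lies strictly above and strictly to the right of each of $c_1,\dots,c_d$; otherwise it avoids the pattern. A $d$-RSK growth diagram on $F$ consists of a filling of $F$ and an assignment of a partition to each lattice point of $F$, such that every lattice point on the coordinate axes is assigned $\emptyset$, and every cell satisfies the $d$-RSK local rule: if the cell has entry $m$ and its bottom-left, top-left, bottom-right, top-right corners are assigned $\kappa,\mu,\nu,\rho$, then all four are $d$-partitions, $\mu\succ\kappa\prec\nu$, $\mu\prec\rho\succ\nu$, $m=0$ or $\kappa_d=0$, and $\rho_1+\kappa_d=m+\min(\mu_d,\nu_d)+\max(\mu_1,\nu_1)$ and $\rho_i+\kappa_{i-1}=\min(\mu_{i-1},\nu_{i-1})+\max(\mu_i,\nu_i)$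 for $2\le i\le d$. For a type sequence $w=w_1\cdots w_r$, a semistandard $w$-oscillating tableau is a sequence of partitions $\emptyset=\lambda^{(0)},\lambda^{(1)},\ldots,\lambda^{(r)}=\emptyset$ with $\lambda^{(i-1)}\prec\lambda^{(i)}$ if $w_i=+$ and $\lambda^{(i-1)}\succ\lambda^{(i)}$ if $w_i=-$; it is $d$-semistandard if all $\lambda^{(i)}$ are $d$-partitions. *)

(* Defs.v *)
From mathcomp Require Import all_boot.
Set Implicit Arguments. Unset Strict Implicit. Unset Printing Implicit Defensive.

(* Partitions: weakly decreasing finite sequences of positive integers.
   [part l i] is lambda_i (1-indexed), 0 beyond the length. *)
Definition is_partition (l : seq nat) : bool :=
  sorted geq l && all (fun x => 0 < x) l.
Definition part (l : seq nat) (i : nat) : nat := nth 0 l i.-1.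
Definition is_dpartition (d : nat) (l : seq nat) : bool :=
  is_partition l && (size l <= d).

Definition interlace (a b : seq nat) : Prop :=
  forall i, 1 <= i -> part a i <= part b i /\ part b i.+1 <= part a i.

(* Young diagram with row lengths sh (row 1 = bottom row, adjacent to x-axis).
   The cell with bottom-left corner (x,y) lies in row y+1, column x+1. *)
Definition in_cell (sh : seq nat) (c : nat * nat) : bool :=
  (c.2 < size sh) && (c.1 < nth 0 sh c.2).

(* lattice points = corners of cells *)
Definition lattice_pt (sh : seq nat) (p : nat * nat) : bool :=
  [|| in_cell sh p,
      (0 < p.1) && in_cell sh (p.1.-1, p.2),
      (0 < p.2) && in_cell sh (p.1, p.2.-1)
    | [&& 0 < p.1, 0 < p.2 & in_cell sh (p.1.-1, p.2.-1)]].

(* Fillings: f : nat * nat -> nat (only values on cells matter). *)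
Definition contains_pattern (d : nat) (sh : seq nat) (f : nat * nat -> nat) : Prop :=
  exists c : nat -> nat * nat,
    (forall i, i <= d -> in_cell sh (c i) /\ f (c i) <> 0) /\
    (forall i, i.+1 < d -> (c i).1 < (c i.+1).1 /\ (c i.+1).2 < (c i).2) /\
    (forall i, i < d -> (c i).1 < (c d).1 /\ (c i).2 < (c d).2).
(* (0-indexed: c 0,...,c (d-1) are c_1,...,c_d and c d is c_(d+1).) *)

(* The d-RSK local rule for a cell with entry m and corners
   kappa (bottom-left), mu (top-left), nu (bottom-right), rho (top-right). *)
Definition local_rule (d m : nat) (kappa mu nu rho : seq nat) : Prop :=
  [/\ is_dpartition d kappa, is_dpartition d mu, is_dpartition d nu
    & is_dpartition d rho] /\
  (interlace kappa mu /\ interlace kappa nu) /\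
  (interlace mu rho /\ interlace nu rho) /\
  (m = 0 \/ part kappa d = 0) /\
  part rho 1 + part kappa d
    = m + minn (part mu d) (part nu d) + maxn (part mu 1) (part nu 1) /\
  (forall i, 2 <= i <= d ->
     part rho i + part kappa i.-1
     = minn (part mu i.-1) (part nu i.-1) + maxn (part mu i) (part nu i)).

Definition growth_diagram (d : nat) (sh : seq nat)
    (f : nat * nat -> nat) (lam : nat * nat -> seq nat) : Prop :=
  (forall p, lattice_pt sh p -> (p.1 = 0 \/ p.2 = 0) -> lam p = [::]) /\
  (forall c, in_cell sh c ->
     local_rule d (f c) (lam c) (lam (c.1, c.2.+1)) (lam (c.1.+1, c.2))
                (lam (c.1.+1, c.2.+1))).

(* Type sequence of the outer boundary (true = '+', up step; false = '-',
   left step), starting on the positive x-axis. *)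
Fixpoint boundary_word (sh : seq nat) : seq bool :=
  match sh with
  | [::] => [::]
  | a :: s => true :: nseq (a - head 0 s) false ++ boundary_word s
  end.

Definition bstep (p : nat * nat) (b : bool) : nat * nat :=
  if b then (p.1, p.2.+1) else (p.1.-1, p.2).

Definition boundary_pts (sh : seq nat) : seq (nat * nat) :=
  (head 0 sh, 0) :: scanl bstep (head 0 sh, 0) (boundary_word sh).

Definition osc_tableau (d : nat) (w : seq bool) (T : seq (seq nat)) : Prop :=
  [/\ size T = (size w).+1,
      all (is_dpartition d) T,
      nth [::] T 0 = [::], nth [::] T (size w) = [::]
    & forall i, i < size w ->
        if nth true w i then interlace (nth [::] T i) (nth [::] T i.+1)
        else interlace (nth [::] T i.+1) (nth [::] T i)].

Definition boundary_seq (sh : seq nat) (lam : nat * nat -> seq nat) :=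
  map lam (boundary_pts sh).

(* Main.v *)
Require Import Defs.
From mathcomp Require Import all_boot.
From mathcomp Require Import zify.
Set Implicit Arguments. Unset Strict Implicit. Unset Printing Implicit Defensive.

(** The local rule is invertible in both directions: [kappa], [mu], [nu], [m]
    determine [rho], and [mu], [nu], [rho] determine both [kappa] and [m].  So a
    growth diagram can be grown from the axes or peeled from the outer boundary;
    the only obstruction to growing is the condition [m = 0 \/ kappa_d = 0].

    That obstruction is a Greene-type statement: the partition at a point has a
    nonzero [d]-th part exactly when the cells below and to the left of the point
    contain a chain [d ... 1] of nonzero entries.  As long as all [d]-th parts
    vanish, the rule is ordinary RSK, in which row [j] is the last-passage time
    of some weights [h_j] and [h_(j+1) = min(mu_j, nu_j) - kappa_j].  Passing from
    [h_j] to [h_(j+1)] shortens the longest descending chain by exactly one. *)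

(** * The local rule and its inverse *)

Lemma part_gt d l i : is_dpartition d l -> d < i -> part l i = 0.
Proof. by case/andP=> _ sl di; rewrite /part nth_default //; lia. Qed.

(** Positivity of the entries recovers the length from the zero-padded parts. *)
Lemma part_inj l l' : is_partition l -> is_partition l' ->
  (forall i, 0 < i -> part l i = part l' i) -> l = l'.
Proof.
have size_le s s' : is_partition s' ->
    (forall i, 0 < i -> part s i = part s' i) -> size s' <= size s.
  move=> /andP[_ /all_nthP pos] eqp; rewrite leqNgt; apply/negP => lt.
  have := eqp (size s).+1 isT; have := pos 0 _ lt.
  by rewrite /part /= (nth_default _ (leqnn _)) => ? ?; lia.
move=> Pl Pl' eqp; apply: (@eq_from_nth _ 0).
  apply/eqP; rewrite eqn_leq !size_le //.
  by move=> i i0; rewrite eqp.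
by move=> i _; exact: (eqp i.+1).
Qed.

(** Partitions carry no zeros, so the zeros among [g 1, ..., g d], a suffix when [g] is weakly
    decreasing, are filtered out. *)
Definition mkpart d (g : nat -> nat) : seq nat :=
  [seq x <- mkseq (fun i => g i.+1) d | 0 < x].

Lemma mkpart_sorted d (g : nat -> nat) :
  (forall i, 1 <= i < d -> g i.+1 <= g i) ->
  sorted geq (mkseq (fun i => g i.+1) d).
Proof.
move=> gd; apply/(sortedP 0) => i; rewrite size_mkseq => id.
rewrite !nth_mkseq //; last lia.
by apply: gd.
Qed.

Lemma geq_trans : transitive geq. Proof. by move=> y x z /=; lia. Qed.

Lemma mkpart_dpartition d (g : nat -> nat) :
  (forall i, 1 <= i < d -> g i.+1 <= g i) -> is_dpartition d (mkpart d g).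
Proof.
move=> gd; rewrite /is_dpartition /is_partition filter_all andbT.
apply/andP; split; first exact: sorted_filter geq_trans _ _ (mkpart_sorted gd).
by rewrite size_filter -{2}(size_mkseq (fun i => g i.+1) d) count_size.
Qed.

Lemma nth_filter_pos (s : seq nat) i :
  sorted geq s -> nth 0 [seq x <- s | 0 < x] i = nth 0 s i.
Proof.
elim: s i => //= a s IH i pth.
case: ltnP => [a0|]; first by case: i => //= i; apply: IH; exact: path_sorted pth.
rewrite leqn0 => /eqP a0; move: pth; rewrite a0 (path_sortedE geq_trans).
case/andP=> /allP s0 _.
have -> : [seq x <- s | 0 < x] = [::].
  by apply/eqP; rewrite -(negbK (_ == _)) -has_filter; apply/hasPn => x /s0 /=; lia.
rewrite nth_nil; case: i => //= i.
case: (ltnP i (size s)) => si; last by rewrite nth_default.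
by have /= := s0 _ (mem_nth 0 si); lia.
Qed.

Lemma part_mkpart d (g : nat -> nat) i :
  (forall i, 1 <= i < d -> g i.+1 <= g i) -> 1 <= i <= d ->
  part (mkpart d g) i = g i.
Proof.
move=> gd /andP[i1 id]; rewrite /part nth_filter_pos; last exact: mkpart_sorted.
by rewrite nth_mkseq ?prednK.
Qed.

(** Without the clause [m = 0 \/ kappa_d = 0] every filling can be grown; that clause is then
    checked separately on the result. *)
Definition weak_rule (d m : nat) (kappa mu nu rho : seq nat) : Prop :=
  [/\ is_dpartition d kappa, is_dpartition d mu, is_dpartition d nu
    & is_dpartition d rho] /\
  (interlace kappa mu /\ interlace kappa nu) /\
  (interlace mu rho /\ interlace nu rho) /\
  part rho 1 + part kappa d
    = m + minn (part mu d) (part nu d) + maxn (part mu 1) (part nu 1) /\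
  (forall i, 2 <= i <= d ->
     part rho i + part kappa i.-1
     = minn (part mu i.-1) (part nu i.-1) + maxn (part mu i) (part nu i)).

Lemma local_ruleE d m kappa mu nu rho :
  local_rule d m kappa mu nu rho <->
  weak_rule d m kappa mu nu rho /\ (m = 0 \/ part kappa d = 0).
Proof. by rewrite /local_rule /weak_rule; tauto. Qed.

(* Nothing is truncated when [kappa] interlaces with [mu] and [nu]. *)
Definition fwd d m (kappa mu nu : seq nat) : seq nat :=
  mkpart d (fun i =>
    if i == 1
    then m + (minn (part mu d) (part nu d) - part kappa d)
           + maxn (part mu 1) (part nu 1)
    else minn (part mu i.-1) (part nu i.-1) - part kappa i.-1
           + maxn (part mu i) (part nu i)).

(** Since [kappa_(i-1) >= max(mu_i, nu_i)], for [i >= 2] the new [rho_i] lies between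
    [max(mu_i, nu_i)] and [min(mu_(i-1), nu_(i-1))]. *)
Lemma fwd_rule d m kappa mu nu : 0 < d ->
  is_dpartition d kappa -> is_dpartition d mu -> is_dpartition d nu ->
  interlace kappa mu -> interlace kappa nu ->
  weak_rule d m kappa mu nu (fwd d m kappa mu nu).
Proof.
move=> d0 Pk Pm Pn km kn; rewrite /fwd; set g := (fun _ => _).
have gd i : 1 <= i < d -> g i.+1 <= g i.
  case: i => // i id; rewrite /g /=; have := km i.+1 isT; have := kn i.+1 isT.
  by case: eqP => [[e]|_]; [move: id; rewrite e | case: i id]; have := km 1 isT; have := kn 1 isT; lia.
have dp := mkpart_dpartition gd.
have gle i : 1 <= i ->
    maxn (part mu i) (part nu i) <= part (mkpart d g) i /\
    part (mkpart d g) i.+1 <= minn (part mu i) (part nu i).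
  move=> i1; have := km i i1; have := kn i i1 => ? ?.
  case: (ltngtP i d) => id.
  - rewrite !part_mkpart //; try lia.
    by rewrite /g /= eqSS (gtn_eqF i1); case: eqP => [e|_]; [subst i|]; lia.
  - rewrite (part_gt dp id) (part_gt dp (leqW id)) (part_gt Pm id) (part_gt Pn id); lia.
  - rewrite (part_gt dp (i := i.+1)) ?id // part_mkpart //; last lia.
    by rewrite /g -id; case: eqP => [->|]; lia.
do !split=> //.
- by have := gle _ H; lia.
- by have := gle _ H; lia.
- by have := gle _ H; lia.
- by have := gle _ H; lia.
- by rewrite part_mkpart //= /g /=; have := km d d0; have := kn d d0; lia.
move=> i id; rewrite part_mkpart //; last lia.
rewrite /g; case: eqP => [|_]; first lia.
have i1 : 1 <= i.-1 by lia.
by have := km _ i1; have := kn _ i1; lia.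
Qed.

Lemma rule_fwd_uniq d m kappa mu nu rho rho' :
  weak_rule d m kappa mu nu rho -> weak_rule d m kappa mu nu rho' -> rho = rho'.
Proof.
case=> [[_ _ _ Pr]] [_ [_ [e1 ei]]] [[_ _ _ Pr']] [_ [_ [e1' ei']]].
apply: part_inj; [by case/andP: Pr | by case/andP: Pr' | move=> i i0].
case: (leqP i d) => id; last by rewrite (part_gt Pr id) (part_gt Pr' id).
case: (eqVneq i 1) => [->|i1]; first lia.
by have := ei i; have := ei' i; lia.
Qed.

(* [bwd_entry] and the [d]-th part of [bwd] are the positive and negative parts
   of the same difference: the clause [m = 0 \/ kappa_d = 0] says that at most
   one of them is nonzero.  The other parts of [bwd] involve no truncation. *)
Definition bwd_entry d (mu nu rho : seq nat) : nat :=
  part rho 1 - (minn (part mu d) (part nu d) + maxn (part mu 1) (part nu 1)).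

Definition bwd d (mu nu rho : seq nat) : seq nat :=
  mkpart d (fun i =>
    if i == d
    then minn (part mu d) (part nu d) + maxn (part mu 1) (part nu 1) - part rho 1
    else minn (part mu i) (part nu i) + maxn (part mu i.+1) (part nu i.+1)
           - part rho i.+1).

Lemma bwd_rule d mu nu rho : 0 < d ->
  is_dpartition d mu -> is_dpartition d nu -> is_dpartition d rho ->
  interlace mu rho -> interlace nu rho ->
  local_rule d (bwd_entry d mu nu rho) (bwd d mu nu rho) mu nu rho.
Proof.
move=> d0 Pm Pn Pr mr nr; rewrite /bwd; set g := (fun i => _).
have := mr 1 isT; have := nr 1 isT => nr1 mr1.
have gd i : 1 <= i < d -> g i.+1 <= g i.
  move=> /andP[i1 id]; rewrite /g (ltn_eqF id); case: eqP => [<-|_];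
    by have := mr i i1; have := nr i i1; have := mr i.+1 isT; have := nr i.+1 isT;
       have := mr i.+2 isT; have := nr i.+2 isT; lia.
have dp := mkpart_dpartition gd.
have gle i : 1 <= i ->
    maxn (part mu i.+1) (part nu i.+1) <= part (mkpart d g) i /\
    part (mkpart d g) i <= minn (part mu i) (part nu i).
  move=> i1; have := mr i i1; have := nr i i1; have := mr i.+1 isT; have := nr i.+1 isT.
  move=> ? ? ? ?; case: (leqP i d) => id; last first.
    by rewrite (part_gt dp id) (part_gt Pm (leqW id)) (part_gt Pn (leqW id)); lia.
  rewrite part_mkpart ?i1 // /g; case: eqP => [e|]; last lia.
  subst i; rewrite (part_gt Pm (ltnSn d)) (part_gt Pn (ltnSn d)); lia.
rewrite /bwd_entry; do !split=> //.
- by have := gle _ H; lia.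
- by have := gle _ H; lia.
- by have := gle _ H; lia.
- by have := gle _ H; lia.
- by rewrite part_mkpart ?d0 ?leqnn // /g eqxx; lia.
- by rewrite part_mkpart ?d0 ?leqnn // /g eqxx; lia.
move=> i id; rewrite part_mkpart //; last lia.
rewrite /g; case: eqP => [|_]; first lia.
have i1 : 1 <= i.-1 by lia.
by have := mr _ i1; have := nr _ i1; rewrite prednK; lia.
Qed.

(** The first equation fixes only the difference [m - kappa_d]; as one of the two vanishes, both are
    determined. The equation for [rho_(i+1)] gives [kappa_i] for [i < d]. *)
Lemma rule_bwd_uniq d m m' kappa kappa' mu nu rho :
  0 < d ->
  local_rule d m kappa mu nu rho -> local_rule d m' kappa' mu nu rho ->
  m = m' /\ kappa = kappa'.
Proof.
move=> d0 [[Pk _ _ _]] [_ [_ [z [e1 ei]]]] [[Pk' _ _ _]] [_ [_ [z' [e1' ei']]]].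
split; first lia.
apply: part_inj; [by case/andP: Pk | by case/andP: Pk' | move=> i i0].
case: (ltngtP i d) => id.
- by have := ei i.+1; have := ei' i.+1 => /=; lia.
- by rewrite (part_gt Pk id) (part_gt Pk' id).
- by rewrite id; lia.
Qed.

(** * Last-passage times and descending chains *)

(** For [k = d] this is the part [d ... 1] of the pattern, confined to the cells below and to the
    left of the point [(X, Y)]. *)
Definition has_chain (h : nat -> nat -> nat) (X Y k : nat) : Prop :=
  exists c : nat -> nat * nat,
    (forall i, i < k -> [/\ (c i).1 < X, (c i).2 < Y & h (c i).1 (c i).2 <> 0]) /\
    (forall i, i.+1 < k -> (c i).1 < (c i.+1).1 /\ (c i.+1).2 < (c i).2).

(* [G] is the last-passage time of the weights [h]: [G x y] is the maximal weight
   of an up-right path of cells in the rectangle below the lattice point [(x, y)]. *)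
Definition passage (X Y : nat) (G h : nat -> nat -> nat) : Prop :=
  [/\ forall x, x <= X -> G x 0 = 0, forall y, y <= Y -> G 0 y = 0 &
      forall x y, x < X -> y < Y ->
        G x.+1 y.+1 = h x y + maxn (G x y.+1) (G x.+1 y)].

(* In RSK, [h'] are the weights handed on from one row to the next. *)
Definition residue (X Y : nat) (G h' : nat -> nat -> nat) : Prop :=
  forall x y, x < X -> y < Y -> h' x y + G x y = minn (G x y.+1) (G x.+1 y).

(** Reflection in the diagonal turns statements on rows into statements on columns. *)
Definition flip2 (G : nat -> nat -> nat) x y := G y x.

Lemma passage_flip X Y G h :
  passage X Y G h -> passage Y X (flip2 G) (flip2 h).
Proof. by case=> Gx Gy GE; split=> // x y xX yY; rewrite /flip2 GE // maxnC. Qed.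

Lemma residue_flip X Y G h :
  residue X Y G h -> residue Y X (flip2 G) (flip2 h).
Proof. by move=> GE x y xX yY; rewrite /flip2 GE // minnC. Qed.

Lemma finite_choice (T : Type) (t0 : T) k (P : nat -> T -> Prop) :
  (forall i, i < k -> exists c, P i c) ->
  exists c : nat -> T, forall i, i < k -> P i (c i).
Proof.
elim: k => [|k IH] ex; first by exists (fun=> t0).
have [c cP] : exists c : nat -> T, forall i, i < k -> P i (c i).
  by apply: IH => i ik; apply: ex; lia.
have [t tP] := ex k (ltnSn k).
exists (fun i => if i == k then t else c i) => i; rewrite ltnS leq_eqVlt.
by case: eqP => [->|_ /cP].
Qed.

Section Row.
Variables (X Y : nat) (G h h' : nat -> nat -> nat).
Hypotheses (pG : passage X Y G h) (rG : residue X Y G h').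

(** If [h' x b = 0] and [G x b < G x b.+1], the minimum is attained at [G x.+1 b = G x b], which is
    less than [G x b.+1 <= G x.+1 b.+1]. *)
Lemma residue_right a b x : a <= x -> x <= X -> b < Y ->
  G a b < G a b.+1 ->
  (exists x', [/\ a <= x', x' < x & h' x' b <> 0]) \/ G x b < G x b.+1.
Proof.
case: pG => _ _ GE; elim: x => [|x IH] ax xX bY lt.
  by right; move: ax; rewrite leqn0 => /eqP <-.
move: ax; rewrite leq_eqVlt => /orP[/eqP <-|ax]; first by right.
case: (IH _ _ _ lt); try lia; first by case=> x' [*]; left; exists x'; split=> //; lia.
have := rG xX bY; have := GE _ _ xX bY.
by case: (eqVneq (h' x b) 0) => [|/eqP ?]; [right; lia | left; exists x; split=> //; lia].
Qed.

(** If [h x b = 0] and [G x.+1 b < G x.+1 b.+1], the maximum is attained at [G x b.+1], which then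
    exceeds [G x.+1 b >= G x b]. *)
Lemma passage_left a b x : a <= x -> x <= X -> b < Y ->
  G x b < G x b.+1 ->
  (exists x', [/\ a <= x', x' < x & h x' b <> 0]) \/ G a b < G a b.+1.
Proof.
case: pG => _ _ GE; elim: x => [|x IH] ax xX bY lt.
  by right; move: ax; rewrite leqn0 => /eqP ->.
move: ax; rewrite leq_eqVlt => /orP[/eqP ->|ax]; first by right.
case: (eqVneq (h x b) 0) => [h0|/eqP ?]; last by left; exists x; split=> //; lia.
have := rG xX bY; have := GE _ _ xX bY => ? ?.
have {}IH : a <= x -> G x b < G x b.+1 -> _ := fun p => IH p (ltnW xX) bY.
case: IH; try lia.
by case=> x' [*]; left; exists x'; split=> //; lia.
Qed.

Lemma passage_mono x y x' y' : x <= x' <= X -> y <= y' <= Y -> G x y <= G x' y'.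
Proof.
case: pG => Gx Gy GE.
have monox z u u' : z <= Y -> u <= u' -> u' <= X -> G u z <= G u' z.
  move=> zY; elim: u' => [|u' IH]; first by rewrite leqn0 => /eqP ->.
  rewrite leq_eqVlt => /orP[/eqP -> //|uu u'X].
  apply: leq_trans (IH _ _) _; try lia.
  by case: z zY {IH} => [|z] zY; [rewrite !Gx //; lia | have := GE _ _ u'X zY; lia].
have monoy z u u' : z <= X -> u <= u' -> u' <= Y -> G z u <= G z u'.
  move=> zX; elim: u' => [|u' IH]; first by rewrite leqn0 => /eqP ->.
  rewrite leq_eqVlt => /orP[/eqP -> //|uu u'X].
  apply: leq_trans (IH _ _) _; try lia.
  by case: z zX {IH} => [|z] zX; [rewrite !Gy //; lia | have := GE _ _ zX u'X; lia].
move=> /andP[? ?] /andP[? ?]; apply: (leq_trans (n := G x' y)).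
  by apply: monox; lia.
by apply: monoy; lia.
Qed.

(** Where [G] is nonzero but the last weight vanishes, one of the two preceding values of [G] is
    nonzero; descent on [x + y] reaches a nonzero weight. *)
Lemma passage_neq0 : G X Y <> 0 <-> has_chain h X Y 1.
Proof.
case: pG => Gx Gy GE; split; last first.
  case=> c [/(_ 0 isT) [cX cY hc] _].
  have := GE _ _ cX cY; have := @passage_mono (c 0).1.+1 (c 0).2.+1 X Y; lia.
suff: forall n x y, x + y <= n -> x <= X -> y <= Y -> G x y <> 0 ->
    exists c, [/\ c.1 < X, c.2 < Y & h c.1 c.2 <> 0].
  move=> /(_ (X + Y) X Y (leqnn _) (leqnn _) (leqnn _)) H /H[c cP].
  by exists (fun=> c); split=> // i; lia.
elim=> [|n IH] [|x] [|y] sz xX yY; rewrite ?Gx ?Gy // GE //.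
case: (eqVneq (h x y) 0) => [h0|/eqP ? _]; last by exists (x, y).
case: (eqVneq (G x y.+1) 0) => [|/eqP ? _]; last by apply: (IH x y.+1) => //; lia.
by move=> ? ?; apply: (IH x.+1 y); lia.
Qed.
End Row.

(* Where [h'] vanishes, a strict vertical increment of [G] propagates to the
   right along a row and a strict horizontal one upwards along a column; when
   the two meet in the cell [(a', b)], [h'] is nonzero there. *)
Lemma residue_between X Y G h h' a b a' b' :
  passage X Y G h -> residue X Y G h' ->
  a < a' -> a' < X -> b' < b -> b < Y -> h a b <> 0 -> h a' b' <> 0 ->
  exists x y, [/\ a < x <= a', b' < y <= b & h' x y <> 0].
Proof.
move=> pG rG aa a'X bb bY hab hab'; have [Gx Gy GE] := pG.
have aX : a < X by lia. have b'Y : b' < Y by lia.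
have e1 := GE _ _ aX bY; have e2 := GE _ _ a'X b'Y.
case: (residue_right (a := a.+1) (b := b) (x := a') pG rG); try lia.
  by case=> x [*]; exists x, b; split=> //; lia.
case: (residue_right (a := b'.+1) (b := a') (x := b)
         (passage_flip pG) (residue_flip rG)); rewrite /flip2; try lia.
  by case=> y [*]; exists a', y; split=> //; lia.
by move=> ? ?; exists a', b; split; [lia | lia | have := rG _ _ a'X bY; lia].
Qed.

(* Dually, where [h] vanishes strict increments propagate to the left and
   downwards, and meet in the cell [(a, b')]. *)
Lemma passage_between X Y G h h' a b a' b' :
  passage X Y G h -> residue X Y G h' ->
  a < a' -> a' < X -> b' < b -> b < Y -> h' a b <> 0 -> h' a' b' <> 0 ->
  exists x y, [/\ a <= x < a', b' <= y < b & h x y <> 0].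
Proof.
move=> pG rG aa a'X bb bY hab hab'; have [Gx Gy GE] := pG.
have aX : a < X by lia. have b'Y : b' < Y by lia.
have e1 := rG _ _ aX bY; have e2 := rG _ _ a'X b'Y.
case: (passage_left (a := a.+1) (b := b') (x := a') pG rG); try lia.
  by case=> x [*]; exists x, b'; split=> //; lia.
case: (passage_left (a := b'.+1) (b := a) (x := b)
         (passage_flip pG) (residue_flip rG)); rewrite /flip2; try lia.
  by case=> y [*]; exists a, y; split=> //; lia.
by move=> ? ?; exists a, b'; split; [lia | lia | have := GE _ _ aX b'Y; lia].
Qed.

(** Consecutive cells of an [h]-chain enclose a cell of [h'], which loses one cell. Conversely,
    consecutive cells of an [h']-chain enclose a cell of [h], and the zeros of [G] on the axes
    supply one more cell at each end. The half-open intervals in [P] make the chosen cells a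
    chain. *)
Lemma chain_residue X Y G h h' k :
  passage X Y G h -> residue X Y G h' ->
  has_chain h X Y k.+2 <-> has_chain h' X Y k.+1.
Proof.
move=> pG rG; split=> -[c [cP cD]].
  pose P i (e : nat * nat) := [/\ (c i).1 < e.1 <= (c i.+1).1,
    (c i.+1).2 < e.2 <= (c i).2 & h' e.1 e.2 <> 0].
  have [c' c'P] : exists c', forall i, i < k.+1 -> P i (c' i).
    apply: finite_choice (0, 0) _ _ _ => i ik.
    have [aX aY ha] := cP i (leqW ik); have [bX bY hb] := cP i.+1 ik.
    have [ab1 ab2] := cD i ik.
    have [x [y [? ? ?]]] := residue_between pG rG ab1 bX ab2 aY ha hb.
    by exists (x, y).
  exists c'; split=> i ik.
    have [? ? ?] := c'P i ik; have [] := cP i.+1 ik; have [] := cP i (leqW ik).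
    by move=> ? ? ? ? ? ?; split=> //; lia.
  by have [] := c'P i (ltnW ik); have [] := c'P i.+1 ik; lia.
pose P i (e : nat * nat) :=
  [/\ i < k.+1 -> e.1 < (c i).1 /\ (c i).2 <= e.2,
      0 < i -> (c i.-1).1 <= e.1 /\ e.2 < (c i.-1).2,
      e.1 < X, e.2 < Y & h e.1 e.2 <> 0].
have [c' c'P] : exists c', forall i, i < k.+2 -> P i (c' i).
  apply: finite_choice (0, 0) _ _ _ => -[|i] ik.
    (* The first cell is found to the left of [c 0] in its row: the strict increment there cannot
       persist down to [x = 0]. *)
    have [cX cY hc] := cP 0 isT; have ? := rG _ _ cX cY; have [Gx Gy GE] := pG.
    case: (passage_left (a := 0) (b := (c 0).2) (x := (c 0).1) pG rG); try lia; last first.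
      by rewrite !Gy //; lia.
    by case=> x [*]; exists (x, (c 0).2); split=> //=; lia.
  move: ik; rewrite ltnS leq_eqVlt => /orP[/eqP[ek]|ik].
    have ik : i < k.+1 by lia.
    (* The last cell is found below the last cell of the [h']-chain, in its column. *)
    have [cX cY hc] := cP i ik; have ? := rG _ _ cX cY; have [Gx Gy GE] := pG.
    case: (passage_left (a := 0) (b := (c i).1) (x := (c i).2)
             (passage_flip pG) (residue_flip rG)); rewrite /flip2; try lia; last first.
      by rewrite !Gx //; lia.
    by case=> y [*]; exists ((c i).1, y); split=> //=; lia.
  have [aX aY ha] := cP i (ltnW ik); have [bX bY hb] := cP i.+1 ik.
  have [ab1 ab2] := cD i ik.
  have [x [y [? ? ?]]] := passage_between pG rG ab1 bX ab2 aY ha hb.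
  by exists (x, y); split=> //=; lia.
exists c'; split=> i ik; first by have [] := c'P i ik.
by have [] := c'P i (ltnW ik); have [] := c'P i.+1 ik => /=; lia.
Qed.

Lemma greene_length n X Y (G h : nat -> nat -> nat -> nat) :
  (forall j, j < n -> passage X Y (G j) (h j)) ->
  (forall j, j.+1 < n -> residue X Y (G j) (h j.+1)) ->
  forall j, j < n -> G j X Y <> 0 <-> has_chain (h 0) X Y j.+1.
Proof.
move=> pG rG j jn.
(* With [k] arbitrary, the induction trades each row for one more cell of the chain. *)
have H k : has_chain (h j) X Y k.+1 <-> has_chain (h 0) X Y (j + k).+1.
  elim: j jn k => [//|j IH] jn k.
  rewrite addSnnS -IH ?(ltnW jn) //.
  exact: iff_sym (chain_residue k (pG j (ltnW jn)) (rG j jn)).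
by have := H 0; rewrite addn0 => Hj; apply: iff_trans Hj; exact: passage_neq0 (pG j jn).
Qed.

(** * Growing from the axes *)

Definition weak_growth (d X Y : nat) (f : nat * nat -> nat)
    (lam : nat * nat -> seq nat) : Prop :=
  [/\ forall x, x <= X -> lam (x, 0) = [::],
      forall y, y <= Y -> lam (0, y) = [::] &
      forall x y, x < X -> y < Y ->
        weak_rule d (f (x, y)) (lam (x, y)) (lam (x, y.+1)) (lam (x.+1, y))
          (lam (x.+1, y.+1))].

Lemma weak_growthW d X Y X' Y' f lam : X' <= X -> Y' <= Y ->
  weak_growth d X Y f lam -> weak_growth d X' Y' f lam.
Proof.
move=> XX YY [lx ly lE]; split=> [x ?|y ?|x y ? ?].
- by apply: lx; lia.
- by apply: ly; lia.
- by apply: lE; lia.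
Qed.

Lemma has_chainW h X Y X' Y' k : X' <= X -> Y' <= Y ->
  has_chain h X' Y' k -> has_chain h X Y k.
Proof.
by move=> ? ? [c [cP cD]]; exists c; split=> // i /cP[*]; split=> //; lia.
Qed.

(* Under the last hypothesis the cyclic term [min(mu_d, nu_d) - kappa_d] that
   d-RSK adds to the first row vanishes, and the rule is ordinary RSK. *)
Lemma part_last_neq0_rsk d X Y f lam : 0 < d -> weak_growth d X Y f lam ->
  (forall x y, x < X -> y < Y ->
     minn (part (lam (x, y.+1)) d) (part (lam (x.+1, y)) d) = 0) ->
  part (lam (X, Y)) d <> 0 <-> has_chain (fun x y => f (x, y)) X Y d.
Proof.
case: d => // d _ [lx ly lE] z.
pose G j x y := part (lam (x, y)) j.+1.
pose h j x y := if j is j'.+1 then minn (G j' x y.+1) (G j' x.+1 y) - G j' x y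
                else f (x, y).
apply: (@greene_length d.+1 X Y G h) => // j jd.
  split=> [x xX|y yY|x y xX yY]; rewrite /G ?lx ?ly //; first by rewrite /part nth_nil.
    by rewrite /part nth_nil.
  have [_ [[km kn] [_ [e1 ei]]]] := lE _ _ xX yY.
  have := z _ _ xX yY; have := km d.+1 isT; have := kn d.+1 isT => ? ? ?.
  case: j jd => [|j] jd; first by rewrite /h; lia.
  by have := ei j.+2; have := km j.+1 isT; have := kn j.+1 isT; rewrite /h /G /=; lia.
move=> x y xX yY; have [_ [[km kn] _]] := lE _ _ xX yY.
by have := km j.+1 isT; have := kn j.+1 isT; rewrite /h /G; lia.
Qed.

Lemma weak_growth_mono d X Y f lam i x y : weak_growth d X Y f lam -> 0 < i ->
  x <= X -> y <= Y -> part (lam (x, y)) i <= part (lam (X, Y)) i.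
Proof.
move=> [lx ly lE] i0.
have mx u : x <= u -> u <= X -> y <= Y -> part (lam (x, y)) i <= part (lam (u, y)) i.
  elim: u => [|u IH] xu uX yY; first by move: xu; rewrite leqn0 => /eqP ->.
  move: xu; rewrite leq_eqVlt => /orP[/eqP -> //|xu].
  apply: leq_trans (IH _ _ _) _ => //; first lia.
  case: y yY {IH} => [|v] yY; first by rewrite !lx //; lia.
  by have [_ [_ [[/(_ i i0)]]]] := lE _ _ uX yY; lia.
have my v : y <= v -> v <= Y -> x <= X -> part (lam (X, y)) i <= part (lam (X, v)) i.
  elim: v => [|v IH] yv vY xX; first by move: yv; rewrite leqn0 => /eqP ->.
  move: yv; rewrite leq_eqVlt => /orP[/eqP -> //|yv].
  apply: leq_trans (IH _ _ _) _ => //; first lia.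
  case: (X) lx lE => [|u] lx lE; first by rewrite !ly //; lia.
  by have [_ [_ [[_ /(_ i i0)]]]] := lE _ _ (ltnSn _) vY; lia.
by move=> xX yY; apply: leq_trans (mx X _ _ _) (my Y _ _ _).
Qed.

(** If the [d]-th part at [(X, Y)] vanishes, monotonicity makes it vanish on the whole rectangle, so
    ordinary RSK excludes a chain. Conversely, a nonzero [d]-th part is traced left or down to a
    point where both neighbours have zero [d]-th part, and there ordinary RSK yields the chain. *)
Lemma part_last_neq0 d X Y f lam : 0 < d -> weak_growth d X Y f lam ->
  part (lam (X, Y)) d <> 0 <-> has_chain (fun x y => f (x, y)) X Y d.
Proof.
move=> d0 H; split; last first.
  move=> ch z; have [] := part_last_neq0_rsk d0 H; last by move=> _ /(_ ch).
  move=> x y xX yY; have := weak_growth_mono (i := d) H d0 (ltnW xX) yY; lia.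
elim: X Y H => [|X IHX] Y wg.
  by case: wg => _ /(_ _ (leqnn _)) -> _; rewrite /part nth_nil.
elim: Y wg => [|Y IHY] wg.
  by case: wg => /(_ _ (leqnn _)) -> _ _; rewrite /part nth_nil.
have wX := weak_growthW (leqnSn X) (leqnn Y.+1) wg.
have wY := weak_growthW (leqnn X.+1) (leqnSn Y) wg.
case: (eqVneq (part (lam (X, Y.+1)) d) 0) => [zX|/eqP nzX _]; last first.
  exact: has_chainW (leqnSn _) (leqnn _) (IHX _ wX nzX).
case: (eqVneq (part (lam (X.+1, Y)) d) 0) => [zY|/eqP nzY _]; last first.
  exact: has_chainW (leqnn _) (leqnSn _) (IHY wY nzY).
(* Every cell has its top-left or bottom-right corner in one of the two smaller rectangles, where
   all [d]-th parts vanish. *)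
apply: (proj1 (part_last_neq0_rsk d0 wg _)) => x y xX yY.
have [xX'|xX'] := leqP x.+1 X.
  have := weak_growth_mono (x := x) (y := y.+1) (i := d) wX d0; lia.
have [yY'|yY'] := leqP y.+1 Y.
  have := weak_growth_mono (x := x.+1) (y := y) (i := d) wY d0; lia.
have [-> ->] : x = X /\ y = Y by lia.
lia.
Qed.

Section Rec2.
Variables (A : Type) (base : nat -> nat -> A) (step : nat -> nat -> A -> A -> A -> A).

(** [step] receives the values at the bottom-left, top-left and bottom-right corners of the cell, in
    this order. *)
Fixpoint rec2 (x : nat) : nat -> A :=
  match x with
  | 0 => base 0
  | x'.+1 => fix col (y : nat) : A :=
      match y with
      | 0 => base x 0
      | y'.+1 => step x' y' (rec2 x' y') (rec2 x' y'.+1) (col y')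
      end
  end.
End Rec2.

Definition fwd_growth d (f : nat * nat -> nat) (p : nat * nat) : seq nat :=
  rec2 (fun _ _ => [::]) (fun x y => fwd d (f (x, y))) p.1 p.2.

Lemma fwd_growth0 d f x : fwd_growth d f (x, 0) = [::].
Proof. by case: x. Qed.

Lemma fwd_growth_rule d f x y : 0 < d ->
  weak_rule d (f (x, y)) (fwd_growth d f (x, y)) (fwd_growth d f (x, y.+1))
    (fwd_growth d f (x.+1, y)) (fwd_growth d f (x.+1, y.+1)).
Proof.
move=> d0; have in0 : interlace [::] [::] by move=> i; rewrite /part !nth_nil.
elim: x y => [|x IHx].
  by elim=> [|y [[_ ? _ ?] [_ [[? _] _]]]]; apply: fwd_rule.
elim=> [|y [[_ ? _ ?] [_ [[? _] _]]]].
  by have [[? ? ? ?] [_ [[_ ?] _]]] := IHx 0; apply: fwd_rule; rewrite ?fwd_growth0.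
by have [[? ? ? ?] [_ [[_ ?] _]]] := IHx y.+1; apply: fwd_rule.
Qed.

Lemma fwd_growth_weak d f X Y : 0 < d -> weak_growth d X Y f (fwd_growth d f).
Proof.
by move=> d0; split=> [x _|y _|x y _ _]; [exact: fwd_growth0 | | exact: fwd_growth_rule].
Qed.

(** * The outer boundary *)

Lemma foldl_bstep_left n p :
  foldl bstep p (nseq n false) = (p.1 - n, p.2).
Proof. by elim: n p => [|n IH] [x y] /=; rewrite ?subn0 // IH /=; congr (_, _); lia. Qed.

Lemma size_boundary_word s : sorted geq s ->
  size (boundary_word s) = head 0 s + size s.
Proof.
elim: s => //= a s IH pth.
rewrite size_cat size_nseq IH; last exact: path_sorted pth.
suff : head 0 s <= a by lia.
by case: s pth {IH} => //= b s /andP[].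
Qed.

(** The starting height [y0] is free so that the induction can remove the bottom row. For [k = 0]
    both bounds on [p.1] are [nth 0 s 0], which pins the starting point. *)
Lemma walk_spec s y0 i : sorted geq s -> i <= size (boundary_word s) ->
  let p := foldl bstep (head 0 s, y0) (take i (boundary_word s)) in
  exists k, [/\ p.2 = y0 + k, k <= size s, nth 0 s k <= p.1 <= nth 0 s k.-1
              & p.1 + i = head 0 s + k].
Proof.
elim: s y0 i => [|a s IH] y0 i /=.
  by case: i => // _ _; exists 0; rewrite addn0.
move=> pth; case: i => [_|i] /=; first by exists 0; rewrite addn0 leqnn.
have sa : head 0 s <= a by case: s pth {IH} => //= b s /andP[].
rewrite ltnS size_cat size_nseq take_cat size_nseq => isz.
case: ltnP => ia.
  rewrite take_nseq; last exact: ltnW.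
  rewrite foldl_bstep_left /=; exists 1 => /=.
  by rewrite nth0; split; lia.
rewrite foldl_cat foldl_bstep_left /= subKn //.
have [|k [-> ks lek ek]] := IH y0.+1 (i - (a - head 0 s)) (path_sorted pth).
  lia.
exists k.+1 => /=; split; try lia.
by case: k {ks ek} lek => [|k] //=; rewrite nth0; lia.
Qed.

Section Shape.
Variable sh : seq nat.
Hypotheses (Psh : is_partition sh) (sh0 : sh != [::]).
Local Notation r := (nth 0 sh).

Lemma in_cellE x y : in_cell sh (x, y) = (x < r y).
Proof. by rewrite /in_cell /=; case: ltnP => //= ys; rewrite nth_default. Qed.

Lemma row_le y y' : y <= y' -> r y' <= r y.
Proof.
have [/(sortedP 0) st _] := andP Psh.
elim: y' => [|y' IH]; first by rewrite leqn0 => /eqP ->.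
rewrite leq_eqVlt => /orP[/eqP -> //|yy]; apply: leq_trans (IH yy).
by case: (ltnP y'.+1 (size sh)) => [/st | ys]; last rewrite nth_default.
Qed.

Lemma row_gt0 y : (0 < r y) = (y < size sh).
Proof.
case: (ltnP y (size sh)) => ys; last by rewrite nth_default.
by have [_ /all_nthP ->] := andP Psh.
Qed.

Lemma lattice_ptE x y : lattice_pt sh (x, y) = (y <= size sh) && (x <= r y.-1).
Proof.
have sz : 0 < size sh by case: (sh) sh0.
rewrite /lattice_pt /= !in_cellE.
have := row_gt0 y; have := row_gt0 y.-1; have := row_le (leq_pred y).
by case: x y => [|x] [|y] /=; lia.
Qed.

Lemma in_cellW x y x' y' : x' <= x -> y' <= y ->
  in_cell sh (x, y) -> in_cell sh (x', y').
Proof. by rewrite !in_cellE => ? /row_le; lia. Qed.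

Lemma cell_lattice x y : in_cell sh (x, y) ->
  [/\ lattice_pt sh (x, y), lattice_pt sh (x, y.+1), lattice_pt sh (x.+1, y)
    & lattice_pt sh (x.+1, y.+1)].
Proof.
rewrite in_cellE !lattice_ptE /= => xy; have := row_gt0 y; have := row_le (leq_pred y).
by split; lia.
Qed.

Lemma lattice_cell x y : lattice_pt sh (x, y) -> exists c,
  [/\ in_cell sh c, x = c.1 \/ x = c.1.+1 & y = c.2 \/ y = c.2.+1].
Proof.
rewrite lattice_ptE => /andP[ys xr]; exists (x.-1, y.-1).
rewrite in_cellE; have := row_gt0 y.-1; have : 0 < size sh by case: (sh) sh0.
by move=> /=; split; lia.
Qed.

Definition bpt i := foldl bstep (head 0 sh, 0) (take i (boundary_word sh)).

Lemma size_bw : size (boundary_word sh) = r 0 + size sh.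
Proof. by rewrite size_boundary_word ?nth0 //; case/andP: Psh. Qed.

Lemma bptS i : i < size (boundary_word sh) ->
  bpt i.+1 = bstep (bpt i) (nth true (boundary_word sh) i).
Proof. by move=> isz; rewrite /bpt (take_nth true) // foldl_rcons. Qed.

Lemma bptP i : i <= size (boundary_word sh) ->
  [/\ lattice_pt sh (bpt i), ~~ in_cell sh (bpt i)
    & (bpt i).1 + i = r 0 + (bpt i).2].
Proof.
move=> isz; have [st _] := andP Psh.
have [k []] := walk_spec 0 st isz; rewrite -/(bpt i); case: (bpt i) => x y /= ->.
by rewrite lattice_ptE in_cellE nth0 add0n => *; split; lia.
Qed.

(** Each step lowers [x - y] by one, which forces the index. Another such point [(x', y')] on the
    same diagonal with [y < y'] would have [x < x'], against [x' <= r y'.-1 <= r y <= x]. *)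
Lemma bpt_index x y : lattice_pt sh (x, y) -> ~~ in_cell sh (x, y) ->
  r 0 - x + y <= size (boundary_word sh) /\ bpt (r 0 - x + y) = (x, y).
Proof.
move=> lxy cxy; have isz : r 0 - x + y <= size (boundary_word sh).
  by move: lxy; rewrite size_bw lattice_ptE; lia.
split=> //; have [] := bptP isz; case: (bpt _) => x' y' /=.
move: lxy cxy; rewrite !lattice_ptE !in_cellE.
have x0 := row_le (leq0n y.-1); move=> ? ? ? ? e.
have [yy|yy|yy] := ltngtP y y'; last by congr (_, _); lia.
- by have : r y'.-1 <= r y by [apply: row_le; lia]; lia.
- by have : r y.-1 <= r y' by [apply: row_le; lia]; lia.
Qed.

Lemma size_boundary_seq lam :
  size (boundary_seq sh lam) = (size (boundary_word sh)).+1.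
Proof. by rewrite size_map /= size_scanl. Qed.

Lemma nth_boundary_seq lam i : i <= size (boundary_word sh) ->
  nth [::] (boundary_seq sh lam) i = lam (bpt i).
Proof.
move=> isz; rewrite (nth_map (0, 0)) /= ?size_scanl //; congr lam.
by case: i isz => [|i] isz; rewrite /bpt ?take0 //= nth_scanl.
Qed.

Lemma boundary_up x y : in_cell sh (x, y) -> ~~ in_cell sh (x.+1, y) ->
  r 0 - x.+1 + y < size (boundary_word sh) /\
  nth true (boundary_word sh) (r 0 - x.+1 + y) = true.
Proof.
move=> cxy nc; have [_ _ l1 l2] := cell_lattice cxy.
have nc2 : ~~ in_cell sh (x.+1, y.+1).
  by apply: contra nc; apply: in_cellW.
have [_ e1] := bpt_index l1 nc; have [s2 e2] := bpt_index l2 nc2.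
rewrite addnS in s2 e2; split=> //; have := bptS s2; rewrite e1 e2.
by case: nth => // -[]; lia.
Qed.

Lemma boundary_left x y : in_cell sh (x, y) -> ~~ in_cell sh (x, y.+1) ->
  r 0 - x.+1 + y.+1 < size (boundary_word sh) /\
  nth true (boundary_word sh) (r 0 - x.+1 + y.+1) = false.
Proof.
move=> cxy nc; have [_ l1 _ l2] := cell_lattice cxy.
have nc2 : ~~ in_cell sh (x.+1, y.+1).
  by apply: contra nc; apply: in_cellW.
have [s1 e1] := bpt_index l1 nc; have [s2 e2] := bpt_index l2 nc2.
have xr : x < r 0 by move: cxy; rewrite in_cellE; have := row_le (leq0n y); lia.
have e : r 0 - x + y.+1 = (r 0 - x.+1 + y.+1).+1 by lia.
rewrite e in s1 e1; split=> //; have := bptS s1; rewrite e1 e2.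
by case: nth => // -[]; lia.
Qed.

Lemma bpt0 : bpt 0 = (r 0, 0).
Proof. by rewrite /bpt take0 nth0. Qed.

Lemma bpt_last : bpt (size (boundary_word sh)) = (0, size sh).
Proof.
have := @bpt_index 0 (size sh); rewrite subn0 -size_bw; case=> //.
  by rewrite lattice_ptE leqnn.
by rewrite in_cellE nth_default.
Qed.

(** * Growth diagrams on the Young diagram, grown and peeled *)

Section Growth.
Variable d : nat.

Lemma growth_weak f lam x y : growth_diagram d sh f lam -> in_cell sh (x, y) ->
  weak_growth d x y f lam.
Proof.
case=> ax rule cxy; split=> [u ux|u uy|u v ux vy].
- apply: ax; last by right.
  by have [] := cell_lattice (in_cellW ux (leq0n y) cxy).
- apply: ax; last by left.
  by have [] := cell_lattice (in_cellW (leq0n x) uy cxy).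
by have /local_ruleE[] := rule _ (in_cellW (ltnW ux) (ltnW vy) cxy).
Qed.

Lemma growth_dpartition f lam p :
  growth_diagram d sh f lam -> lattice_pt sh p -> is_dpartition d (lam p).
Proof.
case: p => x y [_ rule] /lattice_cell[[u v] [cuv ex ey]].
have [[? ? ? ?] _] := rule _ cuv.
by case: ex ey => -> [] ->.
Qed.

(** The cell [c d] has a nonzero entry, so the local rule forces [kappa_d = 0] there, and no chain
    of length [d] lies below and to the left of it. *)
Lemma growth_avoids f lam : 0 < d -> growth_diagram d sh f lam -> ~ contains_pattern d sh f.
Proof.
move=> d0 gr [c [cF [cD cT]]]; have [cd fd] := cF d (leqnn d).
have [_ rule] := gr; have [_ [_ [_ [[//|k0] _]]]] := rule _ cd.
move: k0 cT fd cd; case: (c d) => x y k0 cT fd cd.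
have [_ []] := part_last_neq0 d0 (growth_weak gr cd) => //.
exists c; split=> // i id; have [? ?] := cT i id; have [_] := cF i (ltnW id).
by rewrite -surjective_pairing.
Qed.

Lemma growth_osc f lam : growth_diagram d sh f lam ->
  osc_tableau d (boundary_word sh) (boundary_seq sh lam).
Proof.
move=> gr; have [ax rule] := gr; split.
- exact: size_boundary_seq.
- apply/(all_nthP [::]) => i; rewrite size_boundary_seq ltnS => isz.
  by rewrite nth_boundary_seq //; apply: growth_dpartition gr _; have [] := bptP isz.
- rewrite nth_boundary_seq // bpt0; apply: ax; last by right.
  by rewrite lattice_ptE /= leqnn.
- rewrite nth_boundary_seq // bpt_last; apply: ax; last by left.
  by rewrite lattice_ptE /= leqnn.
move=> i isz; rewrite !nth_boundary_seq //; last exact: ltnW.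
have [l1 c1 e1] := bptP (ltnW isz); have := bptP isz; rewrite bptS //.
move: l1 c1 e1; case: (bpt i) => x y; rewrite lattice_ptE in_cellE /=.
case: (nth true _ _); rewrite /bstep /= lattice_ptE in_cellE /= => l1 c1 e1 [l2 c2 e2].
  case: x l1 c1 e1 l2 c2 e2 => [|x] l1 c1 e1 l2 c2 e2.
    by have := row_gt0 y; lia.
  (* An up step is the right edge of a cell; a left step, treated below, is the top edge of one. *)
  by have [|_ [_ [[_ ?] _]]] := rule (x, y); first by rewrite in_cellE; lia.
have [x0 y0] : 0 < x /\ 0 < y.
  have := row_gt0 0; have : 0 < size sh by case: (sh) sh0.
  case: y l1 c1 e1 l2 c2 e2 => [|y] /= l1 c1 e1 l2 c2 e2; lia.
case: x x0 l1 c1 e1 l2 c2 e2 => // x _; case: y y0 => // y _ /= l1 c1 e1 l2 c2 e2.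
by have [|_ [_ [[? _] _]]] := rule (x, y); first by rewrite in_cellE; lia.
Qed.

Lemma fwd_growth_uniq f lam p : 0 < d -> growth_diagram d sh f lam -> lattice_pt sh p ->
  lam p = fwd_growth d f p.
Proof.
case: p => x y d0 [ax rule]; elim: x y => [|x IHx] y; first by move/ax => ->; [|left].
elim: y => [|y IHy] lxy; first by rewrite ax //; right.
have cxy : in_cell sh (x, y) by move: lxy; rewrite lattice_ptE in_cellE => /andP[].
have [l1 l2 l3 _] := cell_lattice cxy.
have /local_ruleE[] := rule _ cxy; rewrite /= !IHx ?IHy // => wr _.
exact: rule_fwd_uniq wr (fwd_growth_rule f x y d0).
Qed.

(** A cell with nonzero entry and [kappa_d <> 0] would complete a chain of length [d] to the
    forbidden pattern. *)
Lemma fwd_growth_diagram f : 0 < d -> ~ contains_pattern d sh f ->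
  growth_diagram d sh f (fwd_growth d f).
Proof.
move=> d0 av; split=> [[x y] _ /= [] ->|[x y] cxy]; [done | exact: fwd_growth0 |].
apply/local_ruleE; split; first exact: fwd_growth_rule.
case: (eqVneq (f (x, y)) 0) => [|/eqP fxy]; [by left | right].
case: (eqVneq (part (fwd_growth d f (x, y)) d) 0) => // /eqP.
case/(part_last_neq0 d0 (fwd_growth_weak f x y d0)) => c [cP cD]; case: av.
exists (fun i => if i < d then c i else (x, y)); split=> [i|].
  rewrite leq_eqVlt => /orP[/eqP ->|id]; first by rewrite ltnn.
  rewrite id; have [? ?] := cP i id; rewrite -surjective_pairing; split=> //.
  by rewrite [c i]surjective_pairing; apply: in_cellW cxy; apply: ltnW.
split=> i id; first by rewrite id (ltnW id); apply: cD.
by rewrite id ltnn; have [] := cP i id.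
Qed.

(* The recursion runs from the corner [(sh_1, size sh)] of the bounding box
   towards the axes.  The point [(x, y)] of the outer boundary has index
   [sh_1 - x + y], since every step increases [y] or decreases [x]. *)
Definition bwd_growth (T : seq (seq nat)) (p : nat * nat) : seq nat :=
  let t x y := nth [::] T (r 0 - x + y) in
  rec2 (fun a b => t (r 0 - a) (size sh - b))
       (fun a b rho nu mu =>
          let x := r 0 - a.+1 in let y := size sh - b.+1 in
          if in_cell sh (x, y) then bwd d mu nu rho else t x y)
       (r 0 - p.1) (size sh - p.2).

Lemma bwd_growth_cell T x y : in_cell sh (x, y) ->
  bwd_growth T (x, y) = bwd d (bwd_growth T (x, y.+1)) (bwd_growth T (x.+1, y))
    (bwd_growth T (x.+1, y.+1)).
Proof.
move=> cxy; have xr : x < r 0.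
  by move: cxy; rewrite in_cellE; have := row_le (leq0n y); lia.
have ys : y < size sh by case/andP: cxy.
(* Writing both distances to the corner as successors exposes one step of [rec2]. *)
rewrite /bwd_growth /= -(subnSK xr) -(subnSK ys) /= !subnSK //.
by rewrite !subKn ?cxy // ltnW.
Qed.

Lemma bwd_growth_boundary T x y : x <= r 0 -> y <= size sh ->
  ~~ in_cell sh (x, y) -> bwd_growth T (x, y) = nth [::] T (r 0 - x + y).
Proof.
move=> xr ys nc; rewrite /bwd_growth /=.
case ea: (r 0 - x) => [|a] /=; first by rewrite !subn0 subnn subKn.
case eb: (size sh - y) => [|b] /=; first by congr (nth _ _ (_ + _)); lia.
have [-> ->] : r 0 - a.+1 = x /\ size sh - b.+1 = y by lia.
by rewrite (negPf nc) ea.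
Qed.

Definition bwd_filling T (c : nat * nat) : nat :=
  bwd_entry d (bwd_growth T (c.1, c.2.+1)) (bwd_growth T (c.1.+1, c.2))
    (bwd_growth T (c.1.+1, c.2.+1)).

(** Induction on the distance to the corner of the bounding box. The interlacing along the top or
    right edge of the cell comes from the rule in the adjacent cell or, when there is none, from a
    step of [T]. *)
Lemma bwd_growth_rule T x y : 0 < d -> osc_tableau d (boundary_word sh) T ->
  in_cell sh (x, y) ->
  local_rule d (bwd_filling T (x, y)) (bwd_growth T (x, y))
    (bwd_growth T (x, y.+1)) (bwd_growth T (x.+1, y)) (bwd_growth T (x.+1, y.+1)).
Proof.
move=> d0 [szT Tpart _ _ step].
have [n] := ubnP (r 0 - x + (size sh - y)); elim: n x y => // n IH x y le cxy.
have xr : x < r 0.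
  by move: cxy; rewrite in_cellE; have := row_le (leq0n y); lia.
have ys : y < size sh by case/andP: cxy.
have [_ l1 l2 l3] := cell_lattice cxy.
have bd u v : lattice_pt sh (u, v) -> ~~ in_cell sh (u, v) ->
    is_dpartition d (bwd_growth T (u, v)).
  move=> luv nc; have [isz _] := bpt_index luv nc.
  rewrite bwd_growth_boundary //; first by apply: (all_nthP _ Tpart); rewrite szT ltnS.
    by move: luv; rewrite lattice_ptE; have := row_le (leq0n v.-1); lia.
  by move: luv; rewrite lattice_ptE; lia.
rewrite bwd_growth_cell //.
have [Pm mr] : is_dpartition d (bwd_growth T (x, y.+1)) /\
    interlace (bwd_growth T (x, y.+1)) (bwd_growth T (x.+1, y.+1)).
  case c1: (in_cell sh (x, y.+1)).
    by have [|[? _ _ _] [[_ ?] _]] := IH x y.+1 _ c1; first lia.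
  have [isz w] := boundary_left cxy (negbT c1); split; first by rewrite bd ?c1.
  have := step _ isz; rewrite w !bwd_growth_boundary ?c1 //; try lia.
    by have -> : r 0 - x + y.+1 = (r 0 - x.+1 + y.+1).+1 by lia.
  by apply: contraFN c1; apply: in_cellW.
have [Pn nr] : is_dpartition d (bwd_growth T (x.+1, y)) /\
    interlace (bwd_growth T (x.+1, y)) (bwd_growth T (x.+1, y.+1)).
  case c1: (in_cell sh (x.+1, y)).
    by have [|[? _ _ _] [[? _] _]] := IH x.+1 y _ c1; first lia.
  have [isz w] := boundary_up cxy (negbT c1); split; first by rewrite bd ?c1.
  have := step _ isz; rewrite w !bwd_growth_boundary ?c1 ?addnS //; try lia.
  by apply: contraFN c1; apply: in_cellW.
have Pr : is_dpartition d (bwd_growth T (x.+1, y.+1)).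
  case c1: (in_cell sh (x.+1, y.+1)); last by rewrite bd ?c1.
  by have [|[? _ _ _] _] := IH x.+1 y.+1 _ c1; first lia.
exact: bwd_rule.
Qed.

Lemma interlace_nil k : is_dpartition d k -> interlace k [::] -> k = [::].
Proof.
case/andP=> Pk _ ki; apply: part_inj => // i i0.
by have [] := ki i i0; rewrite /part nth_nil; lia.
Qed.

(** On the axes, the empty ends of [T] spread towards the origin, because only the empty partition
    interlaces below the empty one. *)
Lemma bwd_growth_diagram T : 0 < d -> osc_tableau d (boundary_word sh) T ->
  growth_diagram d sh (bwd_filling T) (bwd_growth T).
Proof.
move=> d0 osc; split=> [[x y] lxy|[x y]]; last exact: bwd_growth_rule.
have [szT _ Tfst Tlst _] := osc; case=> /= e; subst.
  have [n] := ubnP (size sh - y); elim: n y lxy => // n IH y lxy le.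
  have ys : y <= size sh by move: lxy; rewrite lattice_ptE; lia.
  case c: (in_cell sh (0, y)).
    have [[? _ _ _] [[km _] _]] := bwd_growth_rule d0 osc c.
    have [_ l1 _ _] := cell_lattice c.
    rewrite (IH y.+1) // in km; first exact: interlace_nil km.
    by move: c; rewrite in_cellE row_gt0; lia.
  rewrite bwd_growth_boundary ?c // subn0.
  by move: c; rewrite in_cellE row_gt0 => ?; apply: etrans Tlst; rewrite size_bw; congr nth; lia.
have [n] := ubnP (r 0 - x); elim: n x lxy => // n IH x lxy le.
have xr : x <= r 0 by move: lxy; rewrite lattice_ptE.
case c: (in_cell sh (x, 0)).
  have [[? _ _ _] [[_ kn] _]] := bwd_growth_rule d0 osc c.
  have [_ _ l1 _] := cell_lattice c.
  rewrite (IH x.+1) // in kn; first exact: interlace_nil kn.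
  by move: c; rewrite in_cellE; lia.
rewrite bwd_growth_boundary ?c // addn0.
by move: c; rewrite in_cellE => ?; apply: etrans Tfst; congr nth; lia.
Qed.

Lemma boundary_bwd_growth T : osc_tableau d (boundary_word sh) T ->
  boundary_seq sh (bwd_growth T) = T.
Proof.
case=> szT _ _ _ _; apply: (@eq_from_nth _ [::]); rewrite size_boundary_seq ?szT //.
move=> i isz; rewrite nth_boundary_seq //.
have [] := bptP (isz : i <= _); case: (bpt i) => x y lxy nc /= e.
move: lxy; rewrite lattice_ptE => /andP[ys xr].
have xr0 := leq_trans xr (row_le (leq0n y.-1)).
by rewrite bwd_growth_boundary //; congr nth; lia.
Qed.

(** Stated for two arbitrary diagrams, it gives both the uniqueness in (c) and the recovery of a
    filling from its boundary. *)
Lemma bwd_growth_uniq f lam f' lam' : 0 < d ->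
  growth_diagram d sh f lam -> growth_diagram d sh f' lam' ->
  boundary_seq sh lam = boundary_seq sh lam' ->
  (forall c, in_cell sh c -> f c = f' c) /\
  (forall p, lattice_pt sh p -> lam p = lam' p).
Proof.
move=> d0 [_ rule] [_ rule'] eb.
have elam : forall p, lattice_pt sh p -> lam p = lam' p.
  move=> [x y]; have [n] := ubnP (r 0 - x + (size sh - y)).
  elim: n x y => // n IH x y le lxy.
  case c: (in_cell sh (x, y)); last first.
    have [isz <-] := bpt_index lxy (negbT c).
    by rewrite -!nth_boundary_seq // eb.
  have xr : x < r 0.
    by move: c; rewrite in_cellE; have := row_le (leq0n y); lia.
  have ys : y < size sh by case/andP: c.
  have [_ l1 l2 l3] := cell_lattice c.
  have := rule _ c; rewrite /= (IH x y.+1) ?(IH x.+1 y) ?(IH x.+1 y.+1) //; try lia.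
  by move=> h; have [] := rule_bwd_uniq d0 h (rule' _ c).
split=> // -[x y] c; have [_ l1 l2 l3] := cell_lattice c.
have := rule _ c; rewrite /= !elam //.
  by move=> h; have [] := rule_bwd_uniq d0 h (rule' _ c).
by have [] := cell_lattice c.
Qed.
End Growth.
End Shape.

Theorem theorem3p3 (d : nat) (sh : seq nat) :
  0 < d -> is_partition sh -> sh != [::] ->
  (* (a) *)
  (forall f lam, growth_diagram d sh f lam ->
     osc_tableau d (boundary_word sh) (boundary_seq sh lam) /\
     ~ contains_pattern d sh f) /\
  (* (b) *)
  (forall f, ~ contains_pattern d sh f ->
     exists lam, growth_diagram d sh f lam /\
       forall lam', growth_diagram d sh f lam' ->
         forall p, lattice_pt sh p -> lam' p = lam p) /\
  (* (c) *)
  (forall T, osc_tableau d (boundary_word sh) T ->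
     exists f lam, [/\ growth_diagram d sh f lam,
       boundary_seq sh lam = T &
       forall f' lam', growth_diagram d sh f' lam' -> boundary_seq sh lam' = T ->
         (forall c, in_cell sh c -> f' c = f c) /\
         (forall p, lattice_pt sh p -> lam' p = lam p)]) /\
  (* consequence: the explicit bijection filling |-> boundary of its growth diagram *)
  (exists (Phi : (nat * nat -> nat) -> seq (seq nat))
          (Psi : seq (seq nat) -> (nat * nat -> nat)),
     [/\ forall f lam, growth_diagram d sh f lam -> Phi f = boundary_seq sh lam,
         forall f, ~ contains_pattern d sh f ->
           osc_tableau d (boundary_word sh) (Phi f),
         forall T, osc_tableau d (boundary_word sh) T ->
           ~ contains_pattern d sh (Psi T),
         forall f, ~ contains_pattern d sh f ->
           forall c, in_cell sh c -> Psi (Phi f) c = f c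
       & forall T, osc_tableau d (boundary_word sh) T -> Phi (Psi T) = T]).
Proof.
move=> d0 Psh sh0.
(* Uniqueness of the forward growth lets [Phi] be defined by [fwd_growth] for every [f], whichever
   growth diagram is given. *)
have phiE f lam : growth_diagram d sh f lam ->
    boundary_seq sh (fwd_growth d f) = boundary_seq sh lam.
  move=> gr; apply: (@eq_from_nth _ [::]); rewrite !size_boundary_seq // => i isz.
  rewrite !nth_boundary_seq //; apply/esym.
  by apply: (fwd_growth_uniq Psh sh0 d0 gr); have [] := bptP Psh sh0 (isz : i <= _).
split=> [f lam gr|].
  by split; [exact: growth_osc gr | exact: growth_avoids gr].
split=> [f av|].
  exists (fwd_growth d f); split; first exact: fwd_growth_diagram.
  by move=> lam gr p; apply: fwd_growth_uniq gr.
split=> [T osc|].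
  exists (bwd_filling sh d T), (bwd_growth sh d T).
  have grT := bwd_growth_diagram Psh sh0 d0 osc.
  have bT := boundary_bwd_growth Psh sh0 osc.
  split=> // f lam gr eT; apply: (bwd_growth_uniq Psh sh0 d0 gr grT).
  by rewrite eT bT.
exists (fun f => boundary_seq sh (fwd_growth d f)), (bwd_filling sh d).
split=> [f lam|f av|T osc|f av c cF|T osc].
- exact: phiE.
- exact (growth_osc Psh sh0 (fwd_growth_diagram Psh sh0 d0 av)).
- exact: growth_avoids d0 (bwd_growth_diagram Psh sh0 d0 osc).
- have gr := fwd_growth_diagram Psh sh0 d0 av.
  have osc := growth_osc Psh sh0 gr.
  (* The peeled and the grown diagram share their boundary, hence their filling. *)
  by have [->] := bwd_growth_uniq Psh sh0 d0 (bwd_growth_diagram Psh sh0 d0 osc) gr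
    (boundary_bwd_growth Psh sh0 osc).
- rewrite (phiE _ _ (bwd_growth_diagram Psh sh0 d0 osc)).
  exact: boundary_bwd_growth.
Qed.
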